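(* Let $A_n$ be the connected anti-regular graph with $n=2k$ or $n=2k+1$ vertices, with eigenvalues labeled as follows: the positive eigenvalues are $\lambda^+_1<\lambda^+_2<\dots<\lambda^+_k$; the negative eigenvalues other than the trivial one are $\lambda^-_{k-1}<\dots<\lambda^-_1$ if $n=2k$ and $\lambda^-_k<\dots<\lambda^-_1$ if $n=2k+1$. Fix $r\in(0,1)$ and $\varepsilon>0$. Then for all sufficiently large $k$ (with the parity of $n$ fixed), \[|\lambda^+_j+\lambda^-_j+1|<\varepsilon\] for every $j\in\{1,2,\dots,k-1\}$ satisfying $\frac{2j}{2k-1}\le r$ if $n$ is even, respectively $\frac{j}{k}\le r$ if $n$ is odd.
   Context: A simple graph is anti-regular if exactly two of its vertices have the same degree. For each $n\ge2$, $A_n$ denotes the unique (up to isomorphism) connected anti-regular graph on $n$ vertices; equivalently the threshold graph with creation sequence $(0,1,0,1,\dots,0,1)$ ($n$ even) or $(0,0,1,0,1,\dots,0,1)$ ($n$ odd), where a $1$ means the new vertex is joined to all previous vertices and a $0$ means it is added isolated. Eigenvalues are those of the adjacency matrix. The eigenvalues of $A_n$ are simple; for $n=2k$ they consist of $-1$ (the trivial eigenvalue), $k$ positive and $k-1$ other negative eigenvalues; for $n=2k+1$ they consist of $0$ (the trivial eigenvalue), $k$ positive and $k$ negative eigenvalues. *)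

(* Defs.v *)
From mathcomp Require Import all_boot all_order all_algebra.
From mathcomp Require Import reals.

Set Implicit Arguments.
Unset Strict Implicit.
Unset Printing Implicit Defensive.

Import Order.TTheory GRing.Theory Num.Theory.
Local Open Scope ring_scope.

Definition simple_graph (n : nat) (e : rel 'I_n) : Prop :=
  symmetric e /\ irreflexive e.

Definition connected_graph (n : nat) (e : rel 'I_n) : Prop :=
  forall x y : 'I_n, connect e x y.

Definition degree (n : nat) (e : rel 'I_n) (x : 'I_n) : nat :=
  #|[set y | e x y]|.

(* There is exactly one unordered pair of distinct vertices of equal degree. *)
Definition antiregular (n : nat) (e : rel 'I_n) : Prop :=
  exists u v : 'I_n,
    [/\ u != v, degree e u = degree e v &
        forall x y : 'I_n, x != y -> degree e x = degree e y ->
          [set x; y] = [set u; v]].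

(* The graph A_n is determined only up to isomorphism, so statements about it
   quantify over all graphs on 'I_n satisfying this predicate. *)
Definition connected_antiregular (n : nat) (e : rel 'I_n) : Prop :=
  [/\ simple_graph e, connected_graph e & antiregular e].

Definition adjacency_matrix (R : realType) (n : nat) (e : rel 'I_n) : 'M[R]_n :=
  \matrix_(i, j) (e i j)%:R.

Definition trivial_eigenvalue (R : realType) (n : nat) : R :=
  if odd n then 0 else -1.

(* The list s is lambda^+_1 < lambda^+_2 < ..., so lambda^+_j is s`_(j - 1). *)
Definition positive_eigenvalues (R : realType) (n : nat) (e : rel 'I_n)
    (s : seq R) : Prop :=
  sorted (fun x y => x < y) s /\
  forall x : R, x \in s <-> eigenvalue (adjacency_matrix R e) x /\ 0 < x.

(* The list s is lambda^-_1 > lambda^-_2 > ..., so lambda^-_j is s`_(j - 1). *)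
Definition negative_nontrivial_eigenvalues (R : realType) (n : nat)
    (e : rel 'I_n) (s : seq R) : Prop :=
  sorted (fun x y => y < x) s /\
  forall x : R, x \in s <->
    [/\ eigenvalue (adjacency_matrix R e) x, x < 0
      & x <> trivial_eigenvalue R n].

(* Main.v *)
Require Import Defs.
From mathcomp Require Import all_boot all_order all_algebra.
From mathcomp Require Import zify ring lra.
From mathcomp Require Import boolp reals topology normedtype derive realfun trigo.

(* In a connected antiregular graph the degrees are 1, ..., n-1 with only n/2
   repeated, and distinct x, y are adjacent iff deg x + deg y >= n.  Eigenvectors
   are therefore functions of the degree, and differences of the eigenvalue
   equation give a three-term recurrence with solution sin(2 d phi) on the low
   degrees, for the eigenvalues
     lambda = -1/2 + f(phi) or -1/2 - f(phi),
     f(phi) = sqrt(1 + sin(phi)^2) / (2 sin(phi)).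
   The equation for phi changes sign between consecutive multiples of pi/(2n),
   alternately for the two signs; the roots so obtained in (0, pi/2), together
   with the trivial eigenvalue, are n eigenvalues, hence all of them.  Thus
   lambda^+_j and lambda^-_j come from angles at distance O(1/k), and these
   stay away from 0 when j <= r k; there f is Lipschitz. *)

Set Implicit Arguments.
Unset Strict Implicit.
Unset Printing Implicit Defensive.

Import Order.TTheory GRing.Theory Num.Theory.
Import numFieldNormedType.Exports.
Local Open Scope ring_scope.

(** * Adjacency is determined by the degrees *)

Lemma degree_gt0 (n : nat) (e : rel 'I_n) (x : 'I_n) :
  (1 < n)%N -> connected_graph e -> (0 < degree e x)%N.
Proof.
move=> n_gt1 conn.
have [y yx] : exists y : 'I_n, y != x.
  case: (pickP (fun y : 'I_n => y != x)) => [y yx|none]; first by exists y.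
  have : (#|predC1 x| = 0)%N by apply: eq_card0 => y; apply: none.
  by rewrite cardC1 card_ord; lia.
have /connectP[[|z p] /= ep yE] := conn x y; first by rewrite yE eqxx in yx.
by case/andP: ep => exz _; apply/card_gt0P; exists z; rewrite inE.
Qed.

Lemma degree_lt (n : nat) (e : rel 'I_n) (x : 'I_n) :
  irreflexive e -> (degree e x < n)%N.
Proof.
move=> irr; have : (degree e x <= #|[set~ x]|)%N.
  apply/subset_leq_card/subsetP => y; rewrite !inE.
  by apply: contraTneq => ->; rewrite irr.
by rewrite cardsC1 card_ord; have := ltn_ord x; lia.
Qed.

Lemma sum_geq (n a : nat) :
  (0 < a)%N -> (\sum_(1 <= d < n) (a <= d) = n - a)%N.
Proof.
move=> a_gt0; elim: n => [|n IHn]; first by rewrite big_geq.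
have [->|n_gt0] := posnP n; first by rewrite big_geq //; lia.
by rewrite big_nat_recr //= IHn; lia.
Qed.

Lemma sum_leq (n a : nat) :
  (a < n)%N -> (\sum_(1 <= d < n) (d <= a) = a)%N.
Proof.
move=> a_lt; suff -> : (\sum_(1 <= d < n) (d <= a) = minn a n.-1)%N by lia.
elim: n a_lt => [|n IHn] // a_lt; have [->|n_gt0] := posnP n.
  by rewrite big_geq //; lia.
rewrite big_nat_recr //=; have [an|na] := ltnP a n; first by rewrite IHn; lia.
have -> : (\sum_(1 <= d < n) (d <= a) = \sum_(1 <= d < n) 1)%N.
  by apply: eq_big_nat => d dn; lia.
by rewrite sum_nat_const_nat; lia.
Qed.

Section AntiregularStructure.

Variables (n : nat) (e : rel 'I_n) (u v : 'I_n).
Local Notation D := (degree e).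
Hypotheses (n_gt1 : (1 < n)%N) (sym : symmetric e) (irr : irreflexive e).
Hypothesis conn : connected_graph e.
Hypotheses (uv : u != v) (Duv : D u = D v).
Hypothesis tie : forall x y, x != y -> D x = D y -> [set x; y] = [set u; v].

(** By [tie], the vertices other than [v] have distinct degrees; these are n - 1 numbers between 1
    and n - 1, so each value occurs once. The extra term comes from [v]. *)
Lemma sum_degree (M : nmodType) (F : nat -> M) :
  \sum_x F (D x) = \sum_(1 <= d < n) F d + F (D u).
Proof.
rewrite (bigD1 v) //= addrC -Duv; congr (_ + _).
have -> : \sum_(x | x != v) F (D x) = \sum_(x <- enum (predC1 v)) F (D x).
  by rewrite big_enum.
rewrite -(big_map D xpredT F); apply: perm_big.
have szs : size [seq D x | x <- enum (predC1 v)] = n.-1.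
  by rewrite size_map -cardE cardC1 card_ord.
have inj_s : uniq [seq D x | x <- enum (predC1 v)].
  rewrite map_inj_in_uniq ?enum_uniq // => x y.
  rewrite !mem_enum !inE => xv yv Dxy.
  apply/eqP; apply: contraT => xy; have /setP/(_ v) := tie xy Dxy.
  by rewrite !inE eqxx orbT !(eq_sym v) (negbTE xv) (negbTE yv).
have s_sub : {subset [seq D x | x <- enum (predC1 v)] <= index_iota 1 n}.
  move=> d /mapP[x _ ->]; rewrite mem_index_iota.
  by rewrite degree_gt0 // degree_lt.
apply: uniq_perm => //; first exact: iota_uniq.
apply: (uniq_min_size inj_s s_sub _).2.
by rewrite szs size_iota; lia.
Qed.

Lemma card_degree_set (P : pred nat) :
  #|[set x | P (D x)]| = (\sum_(1 <= d < n) P d + P (D u))%N.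
Proof.
rewrite -sum1_card big_mkcond /=.
rewrite -[RHS](sum_degree (fun d => P d : nat)).
by apply: eq_bigr => x _; rewrite inE; case: (P _).
Qed.

Lemma degree_surj (d : nat) : (0 < d < n)%N -> exists x, D x = d.
Proof.
move=> dn; have : (0 < #|[set x | D x == d]|)%N.
  rewrite (card_degree_set (fun d' => d' == d)) addn_gt0 (bigD1_seq d) ?eqxx //=.
    by rewrite mem_index_iota.
  exact: iota_uniq.
by case/card_gt0P => x; rewrite inE => /eqP Dx; exists x.
Qed.

Local Notation edge x y := (n <= D x + D y)%N.

(* The neighbours of a vertex of degree n - t.+1 avoid all the vertices of
   degree at most t, so there are just enough of them left. *)
Lemma high_degree_adj (t : nat) :
  (2 * t + 1 < n)%N -> (t < D u)%N ->
  (forall x y, (D x <= t)%N -> x != y -> e x y = edge x y) ->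
  forall x y, D x = (n - t.+1)%N -> x != y -> e x y = edge x y.
Proof.
move=> tn tu low x y Dx xy.
have cardL : #|[set z | D z <= t]%N| = t.
  by rewrite (card_degree_set (fun d => d <= t)%N) sum_leq; lia.
have subN : [set z | e x z] \subset ~: (x |: [set z | D z <= t]%N).
  apply/subsetP => z; rewrite !inE => exz; apply/norP; split.
    by apply: contraTneq exz => ->; rewrite irr.
  apply/negP => Dz; have zx : z != x by apply: contraTneq exz => ->; rewrite irr.
  by move: exz; rewrite sym low //; lia.
have /eqP NE : [set z | e x z] == ~: (x |: [set z | D z <= t]%N).
  rewrite eqEcard subN cardsCs setCK cardsU1 cardL inE card_ord.
  by rewrite -/(degree e x) Dx; lia.
have := in_set (e x) y; rewrite -[RHS]/(e x y) => <-.
rewrite NE !inE eq_sym (negbTE xy) /=; lia.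
Qed.

(** The degrees are settled from both ends inward. The position of the repeated degree belongs to
    the induction because it fixes how many vertices each end contains, and these counts force the
    neighbourhoods. *)
Lemma degree_adj_ends (t : nat) : (2 * t < n)%N ->
  [/\ forall x y, (D x <= t)%N || (n - t <= D x)%N -> x != y -> e x y = edge x y,
      (D u < n - t)%N & (2 * t + 1 < n)%N -> (t < D u)%N].
Proof.
elim: t => [|t IHt] tn.
  split=> [x y||_].
  - by have := degree_gt0 x n_gt1 conn; have := degree_lt x irr; lia.
  - by rewrite subn0 degree_lt.
  - exact: degree_gt0.
have [IH1 IH2 IH3] := IHt ltac:(lia).
have tu : (t < D u)%N by apply: IH3; lia.
have high x y : (n - t.+1 <= D x)%N -> x != y -> e x y = edge x y.
  rewrite leq_eqVlt => /orP[/eqP Dx|Dx] xy; last by apply: IH1; lia.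
  apply: (@high_degree_adj t); [lia|exact: tu| |by []|by []].
  by move=> x' y' Dx'; apply: IH1; rewrite Dx'.
have cardT : #|[set z | n - t.+1 <= D z]%N| = (t.+1 + (n - t.+1 <= D u))%N.
  by rewrite (card_degree_set (fun d => n - t.+1 <= d)%N) sum_geq; lia.
have highN x : D x = t.+1 -> [set z | n - t.+1 <= D z]%N \subset [set z | e x z].
  move=> Dx; apply/subsetP => z; rewrite !inE => Dz.
  have zx : z != x by apply: contraTneq Dz => ->; lia.
  by rewrite sym high //; lia.
have [x0 Dx0] : exists x, D x = t.+1 by apply: degree_surj; lia.
(* A repeated degree of n - t - 1 or more would give a vertex of degree t + 1 at least t + 2
   neighbours. *)
have ut : (D u < n - t.+1)%N.
  have := subset_leq_card (highN _ Dx0); rewrite cardT -/(degree e x0) Dx0.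
  by lia.
have adj x y : (D x <= t.+1)%N || (n - t.+1 <= D x)%N -> x != y ->
    e x y = edge x y.
  case/orP=> [Dx|]; last exact: high.
  have [Dxt|] := leqP (D x) t; first by apply: IH1; rewrite Dxt.
  move=> tDx xy; have {tDx} Dx : D x = t.+1 by lia.
  have /eqP NE : [set z | n - t.+1 <= D z]%N == [set z | e x z].
    by rewrite eqEcard highN // cardT -/(degree e x) Dx; lia.
  by have := in_set (e x) y; rewrite -[RHS]/(e x y) => <-; rewrite -NE inE; lia.
(* Otherwise t + 2 vertices have degree at most t + 1. A vertex of degree n - t - 2 is adjacent
   neither to them nor to itself, which leaves only n - t - 3 neighbours. *)
split=> // tn1; rewrite ltnNge; apply/negP => Du.
have cardL : #|[set z | D z <= t.+1]%N| = t.+2.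
  by rewrite (card_degree_set (fun d => d <= t.+1)%N) sum_leq; lia.
have [z Dz] : exists z, D z = (n - t.+2)%N by apply: degree_surj; lia.
have subN : [set y | e z y] \subset ~: (z |: [set y | D y <= t.+1]%N).
  apply/subsetP => y; rewrite !inE => ezy.
  have yz : y != z by apply: contraTneq ezy => ->; rewrite irr.
  rewrite (negbTE yz) /=; apply/negP => Dy.
  by move: ezy; rewrite sym adj //; lia.
have := subset_leq_card subN.
by rewrite -/(degree e z) cardsCs setCK cardsU1 cardL inE card_ord Dz; lia.
Qed.

(** The largest admissible values of t for the two bounds of [degree_adj_ends] squeeze the repeated
    degree from above and from below. *)
Lemma tie_degree : D u = n./2.
Proof.
have n2 := odd_double_half n.
have [_ hi _] := @degree_adj_ends (n.-1)./2 ltac:(lia).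
have [_ _ lo] := @degree_adj_ends (n.-2)./2 ltac:(lia).
by have := lo ltac:(lia); lia.
Qed.

Lemma antiregular_adj (x y : 'I_n) : x != y -> e x y = (n <= D x + D y)%N.
Proof.
move=> xy; have n2 := odd_double_half n.
have [|mid] := boolP ((D x <= n.-1./2) || (n - n.-1./2 <= D x))%N.
  by have [adj _ _] := @degree_adj_ends (n.-1)./2 ltac:(lia); move/adj; apply.
(* The one degree left is n/2 for even n, which equals n - (t + 1) with t = (n - 2)/2. *)
have [adj _ lo] := @degree_adj_ends (n.-2)./2 ltac:(lia).
apply: (@high_degree_adj (n.-2)./2) => //; [lia|apply: lo; lia| |lia].
by move=> x' y' Dx'; apply: adj; rewrite Dx'.
Qed.

End AntiregularStructure.

(** * Eigenvectors depending on the degree *)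

Section Eigenvectors.

Variables (R : realType) (n : nat) (e : rel 'I_n).
Hypotheses (n_gt1 : (1 < n)%N) (car : connected_antiregular e).

(** This is the eigenvalue equation for the vector x -> g (deg x). A vertex of degree d sees the
    degrees from n - d on; the second term counts the second vertex of degree n/2, and the last one
    removes the vertex itself when 2 d >= n. Some vertex has degree n - 1, so the vector is
    nonzero. *)
Lemma antiregular_eigenvalue (lam : R) (g : nat -> R) :
  (forall d, (0 < d < n)%N ->
    lam * g d = \sum_(n - d <= i < n) g i + (n <= d + n./2)%N%:R * g n./2
                - (n <= d + d)%N%:R * g d) ->
  g n.-1 != 0 -> eigenvalue (adjacency_matrix R e) lam.
Proof.
case: car => -[sym irr] conn [u [v [uv Duv tie]]].
move=> gE g_neq0; apply/eigenvalueP; exists (\row_x g (degree e x)).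
  apply/rowP => y; rewrite !mxE gE; last by rewrite degree_gt0 ?degree_lt.
  set D := degree e y; transitivity
    (\sum_x (n <= D + degree e x)%N%:R * g (degree e x) - (n <= D + D)%N%:R * g D).
    rewrite (bigD1 y) //= [in RHS](bigD1 y) //= !mxE irr mulr0 add0r.
    rewrite addrAC subrr add0r; apply: eq_bigr => x xy.
    by rewrite !mxE (antiregular_adj n_gt1 sym irr conn uv Duv tie) // addnC mulrC.
  rewrite (sum_degree n_gt1 irr conn uv Duv tie
            (fun d => (n <= D + d)%N%:R * g d)).
  rewrite (tie_degree n_gt1 sym irr conn uv Duv tie); congr (_ + _ - _).
  have Dn : (0 < D < n)%N by rewrite degree_gt0 ?degree_lt.
  rewrite (@big_cat_nat _ _ _ (n - D)%N) /=; [|lia|lia].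
  rewrite big_nat big1 ?add0r => [|i iD]; last first.
    by rewrite (_ : (n <= D + i)%N = false) ?mul0r //; lia.
  apply: eq_big_nat => i iD.
  by rewrite (_ : (n <= D + i)%N = true) ?mul1r //; lia.
have [x Dx] : exists x, degree e x = n.-1.
  by apply: (degree_surj n_gt1 irr conn uv Duv tie); lia.
by apply: contraNneq g_neq0 => /rowP/(_ x); rewrite !mxE Dx => ->.
Qed.

(** The two vertices of equal degree have the same neighbours apart from each other, so the
    difference of their indicators is an eigenvector. They are adjacent exactly when n is even. *)
Lemma trivial_eigenvalueP :
  eigenvalue (adjacency_matrix R e) (trivial_eigenvalue R n).
Proof.
case: car => -[sym irr] conn [u [v [uv Duv tie]]].
have adj := antiregular_adj n_gt1 sym irr conn uv Duv tie.
have Du := tie_degree n_gt1 sym irr conn uv Duv tie.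
apply/eigenvalueP; exists (delta_mx 0 u - delta_mx 0 v); last first.
  apply/eqP => /rowP/(_ u); rewrite !mxE !eqxx (negbTE uv) subr0.
  by move/eqP; rewrite oner_eq0.
have euv : e u v = ~~ odd n by rewrite adj // -Duv Du; have := odd_double_half n; lia.
rewrite mulmxBl -!rowE; apply/rowP => y; rewrite !mxE !eqxx /=.
have [->|yu] := eqVneq y u.
  rewrite irr (sym v u) euv (negbTE uv) /trivial_eigenvalue; case: odd => /=; ring.
have [->|yv] := eqVneq y v.
  rewrite irr euv /trivial_eigenvalue; case: odd => /=; ring.
by rewrite !(adj _ y) 1?eq_sym // Duv; ring.
Qed.

Lemma size_uniq_eigenvalues (s : seq R) :
  uniq s -> {in s, forall x, eigenvalue (adjacency_matrix R e) x} ->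
  (size s <= n)%N.
Proof.
move=> s_uniq eig; have := @max_poly_roots _ (char_poly (adjacency_matrix R e)) s.
rewrite size_char_poly ltnS; apply => //.
  exact/monic_neq0/char_poly_monic.
by apply/allP => x /eig; rewrite eigenvalue_root_char.
Qed.

(* The boundary condition says that the two formulas defining the
   eigenvector agree on the middle degree n./2. *)
Lemma trig_eigenvalue (phi p : R) :
  sin phi != 0 -> cos phi != 0 -> (2 < n)%N ->
  p * (p + 2 * sin phi) = 1 ->
  sin (2 * n./2%:R * phi) = p * cos ((2 * (n - n./2)%:R - 1) * phi) ->
  eigenvalue (adjacency_matrix R e) (p / (2 * sin phi)).
Proof.
move=> s0 c0 n_gt2 pE bc; set h := n./2; set lam := p / (2 * sin phi).
have n2 : (n = 2 * h)%N \/ (n = 2 * h + 1)%N by have := odd_double_half n; lia.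
(* Here p = 2 lam sin(phi), and the hypothesis on p reads 4 lam (lam + 1) sin(phi)^2 = 1.
   Subtracting the equations of degrees i and i - 1 forces the value lam (sin(2 i phi) - sin(2 (i -
   1) phi)) = [b i] at degree n - i. *)
pose b i := p * cos ((2 * i%:R - 1) * phi).
pose g d := if (d <= h)%N then sin (2 * d%:R * phi) else b (n - d)%N.
have gb d : (h <= d)%N -> g d = b (n - d)%N.
  by rewrite /g leq_eqVlt => /orP[/eqP <-|]; [rewrite leqnn bc | case: leqP].
have s20 : 2 * sin phi != 0 by rewrite mulf_neq0 // pnatr_eq0.
have lamE : lam * (2 * sin phi) = p by rewrite /lam divfK.
have lam1E : (lam + 1) * p * (2 * sin phi) = 1 by rewrite mulrAC mulrDl lamE mul1r mulrC.
have lam1C c : (lam + 1) * (p * c) * (2 * sin phi) = c.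
  by rewrite (mulrA (lam + 1)) mulrAC lam1E mul1r.
have low d : (d <= h)%N -> \sum_(n - d <= i < n) g i = lam * g d.
  move=> dh; rewrite {2}/g dh; elim: d dh => [|d IHd] dh.
    by rewrite subn0 big_geq // mulr0 mul0r sin0 mulr0.
  rewrite big_ltn; last by lia.
  rewrite (_ : (n - d.+1).+1 = n - d)%N; last by lia.
  rewrite IHd ?(ltnW dh) // gb; last by lia.
  rewrite (_ : n - (n - d.+1) = d.+1)%N; last by lia.
  apply: (mulIf s20); rewrite /b -lamE.
  rewrite (_ : 2 * d%:R * phi = (2 * d%:R + 1) * phi - phi); last by ring.
  rewrite (_ : 2 * d.+1%:R * phi = (2 * d%:R + 1) * phi + phi); last first.
    by rewrite -[d.+1]addn1 natrD; ring.
  rewrite (_ : (2 * d.+1%:R - 1) * phi = (2 * d%:R + 1) * phi); last first.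
    by rewrite -[d.+1]addn1 natrD; ring.
  by rewrite !sinD sinN cosN; ring.
(* This is the equation at degree n - m, with the self term moved to the right. It is proved
   downward from m = n - h, where it reduces to [low] at h; each step adds sin(2 m phi) = (lam + 1)
   (b m - b (m + 1)). *)
have high m : (0 < m <= n - h)%N ->
    \sum_(m <= i < n) g i + g h = (lam + 1) * b m.
  have [i] := ubnP (n - h - m); elim: i m => // i IHi m im mh.
  have [->|mnh] := eqVneq m (n - h)%N.
    by rewrite low // -gb //; ring.
  rewrite big_ltn; last by lia.
  rewrite -addrA IHi; [|lia|lia].
  rewrite {1}/g (_ : (m <= h)%N); last by lia.
  apply: (mulIf s20); rewrite /b mulrDl !lam1C.
  rewrite (_ : (2 * m.+1%:R - 1) * phi = 2 * m%:R * phi + phi); last first.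
    by rewrite -[m.+1]addn1 natrD; ring.
  rewrite (_ : (2 * m%:R - 1) * phi = 2 * m%:R * phi - phi); last by ring.
  by rewrite !cosD sinN cosN; ring.
apply: (@antiregular_eigenvalue _ g); last first.
  rewrite gb; last by lia.
  rewrite (_ : n - n.-1 = 1)%N; last by lia.
  rewrite /b mulr1 (_ : 2 - 1 = 1) ?mul1r; last by ring.
  by apply: mulf_neq0 => //; apply: contra_eq_neq pE => ->; rewrite mul0r eq_sym oner_eq0.
move=> d dn; have [dh|hd] := leqP d h.
  (* For d <= h the two correction terms either vanish or, when n is even and d = h, cancel. *)
  rewrite low // (_ : (n <= d + h) = (n <= d + d))%N; last by lia.
  have [|_] := boolP (n <= d + d)%N; last by rewrite !mul0r subr0 addr0.
  by move=> nd; rewrite (_ : d = h); [rewrite -/h; ring | lia].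
rewrite (_ : (n <= d + h) = true)%N; last by lia.
rewrite (_ : (n <= d + d) = true)%N; last by lia.
by rewrite !mul1r high ?gb; [ring|lia|lia].
Qed.

End Eigenvectors.

(** * Roots of the secular equation *)

Section Trigonometry.

Variable R : realType.
Implicit Types (phi : R) (n m k : nat) (b : bool).

Lemma sinDmpi m (x : R) : sin (m%:R * pi + x) = (-1) ^+ m * sin x.
Proof. by rewrite addrC mulr_natl (alternatingn (@sinDpi R)). Qed.

Lemma cosDmpi m (x : R) : cos (m%:R * pi + x) = (-1) ^+ m * cos x.
Proof. by rewrite addrC mulr_natl (alternatingn (@cosDpi R)). Qed.

Lemma IVT_sign_change (F : R -> R) (x y : R) : continuous F ->
  x < y -> F x * F y < 0 -> exists z, [/\ x < z, z < y & F z = 0].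
Proof.
move=> Fc xy Fxy; have [] := @IVT R F x y 0 (ltW xy).
- exact: continuous_subspaceT.
- by rewrite ge_min le_max; nra.
move=> z; rewrite in_itv /= => /andP[xz zy] Fz; exists z; split=> //.
  by rewrite lt_neqAle xz andbT; apply: contraTneq Fxy => ->; rewrite Fz mul0r ltxx.
by rewrite lt_neqAle zy andbT; apply: contraTneq Fxy => <-; rewrite Fz mulr0 ltxx.
Qed.

(** The roots of p (p + 2 sin(phi)) = 1 are p = - sin(phi) + [qsin phi] and p = - sin(phi) -
    [qsin phi]. *)
Definition qsin phi : R := Num.sqrt (1 + sin phi ^+ 2).

Lemma qsin_sqr phi : qsin phi ^+ 2 = 1 + sin phi ^+ 2.
Proof. by rewrite sqr_sqrtr // addr_ge0 ?sqr_ge0. Qed.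

Lemma qsin_gt0 phi : 0 < qsin phi.
Proof. by rewrite sqrtr_gt0 ltr_pwDl ?sqr_ge0. Qed.

Lemma continuous_qsin : continuous qsin.
Proof.
move=> x; apply: continuous_comp; last exact: sqrt_continuous.
apply: continuousD; first exact: cst_continuous.
by apply: (@continuous_comp _ _ _ (@sin R) (fun y => y ^+ 2)); [exact: continuous_sin|exact: exprn_continuous].
Qed.

Definition abs_shift phi : R := qsin phi / (2 * sin phi).

(* The boundary condition of trig_eigenvalue for the eigenvalue
   -1/2 + (-1)^b * abs_shift phi, cleared of denominators. *)
Definition secular n b phi : R :=
  if odd n then sin (n%:R * phi) * cos phi - (-1) ^+ b * qsin phi * cos (n%:R * phi)
  else cos (n%:R * phi) * cos phi - (-1) ^+ b * qsin phi * sin (n%:R * phi).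

Lemma continuous_secular n b : continuous (secular n b).
Proof.
have cS : continuous (fun x : R => sin (n%:R * x)).
  by move=> x; apply: continuous_comp; [exact: mulrl_continuous|exact: continuous_sin].
have cC : continuous (fun x : R => cos (n%:R * x)).
  by move=> x; apply: continuous_comp; [exact: mulrl_continuous|exact: continuous_cos].
have cQ : continuous (fun x => (-1) ^+ b * qsin x).
  by move=> x; apply: cvgM; [exact: cvg_cst|exact: continuous_qsin].
rewrite /secular; case: odd => x; apply: cvgB; apply: cvgM;
  by [exact: cS|exact: cC|exact: cQ|exact: continuous_cos].
Qed.

(** At the endpoints n phi is a multiple of pi/2, so one of the two terms of [secular] vanishes. The
    product of the endpoint values is minus a cosine times a value of [qsin]; the bound on m keeps
    the argument of that cosine below pi/2. *)
Lemma secular_root n b m : (2 * m + 1 + b < n)%N ->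
  exists phi, [/\ (m%:R + b%:R / 2) * pi / n%:R < phi,
    phi < (m%:R + (b%:R + 1) / 2) * pi / n%:R & secular n b phi = 0].
Proof.
move=> mn; have pi0 := pi_gt0 R.
have n0 : 0 < n%:R :> R by rewrite ltr0n; lia.
have mnR : 2 * m%:R + 1 + b%:R < n%:R :> R by rewrite -natrM !natr1 -natrD ltr_nat; lia.
have m0 : 0 <= m%:R :> R by exact: ler0n.
apply: IVT_sign_change; first exact: continuous_secular.
  by rewrite ltr_pM2r ?invr_gt0 // ltr_pM2r //; lra.
set x := _ / n%:R; set y := _ / n%:R.
have nx : n%:R * x = (m%:R + b%:R / 2) * pi by rewrite mulrC divfK // gt_eqF.
have ny : n%:R * y = (m%:R + (b%:R + 1) / 2) * pi by rewrite mulrC divfK // gt_eqF.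
have cos0 (z : R) : 0 <= n%:R * z -> 2 * (n%:R * z) < n%:R * pi -> 0 < cos z.
  rewrite (pmulr_rge0 _ n0) => z0; rewrite (_ : 2 * (_ * z) = n%:R * (2 * z)); last by ring.
  by rewrite (ltr_pM2l n0) => zpi; apply: cos_gt0_pihalf; lra.
have sg2 : ((-1) ^+ m : R) ^+ 2 = 1 by rewrite sqrr_sign.
have [qx qy] := (qsin_gt0 x, qsin_gt0 y).
clearbody x y; case: b mn mnR nx ny => /= mn mnR nx ny.
- have {}nx : n%:R * x = m%:R * pi + pi / 2 by rewrite nx; field.
  have {}ny : n%:R * y = m%:R * pi + pi by rewrite ny; field.
  rewrite /secular nx ny !sinDmpi !cosDmpi sinpi cospi sin_pihalf cos_pihalf.
  case: odd.
    have cx : 0 < cos x by apply: cos0; rewrite nx; nra.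
    rewrite [ltLHS](_ : _ = - ((-1) ^+ m) ^+ 2 * (cos x * qsin y)); last by ring.
    by rewrite sg2 mulN1r oppr_lt0 mulr_gt0.
  have cy : 0 < cos y by apply: cos0; rewrite ny; nra.
  rewrite [ltLHS](_ : _ = - ((-1) ^+ m) ^+ 2 * (cos y * qsin x)); last by ring.
  by rewrite sg2 mulN1r oppr_lt0 mulr_gt0.
- have {}nx : n%:R * x = m%:R * pi + 0 by rewrite nx; field.
  have {}ny : n%:R * y = m%:R * pi + pi / 2 by rewrite ny; field.
  rewrite /secular nx ny !sinDmpi !cosDmpi sin0 trigo.cos0 sin_pihalf cos_pihalf.
  case: odd.
    have cy : 0 < cos y by apply: cos0; rewrite ny; nra.
    rewrite [ltLHS](_ : _ = - ((-1) ^+ m) ^+ 2 * (cos y * qsin x)); last by ring.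
    by rewrite sg2 mulN1r oppr_lt0 mulr_gt0.
  have cx : 0 < cos x by apply: cos0; rewrite nx; nra.
  rewrite [ltLHS](_ : _ = - ((-1) ^+ m) ^+ 2 * (cos x * qsin y)); last by ring.
  by rewrite sg2 mulN1r oppr_lt0 mulr_gt0.
Qed.

Lemma secular_eigenvalue n (e : rel 'I_n) b phi :
  (2 < n)%N -> connected_antiregular e -> 0 < phi -> phi < pi / 2 ->
  secular n b phi = 0 ->
  eigenvalue (adjacency_matrix R e) (- 1 / 2 + (-1) ^+ b * abs_shift phi).
Proof.
move=> n_gt2 car phi0 phi1 sec.
have s0 : 0 < sin phi by apply: sin_gt0_pihalf; rewrite phi0.
have c0 : 0 < cos phi by apply: cos_gt0_pihalf; lra.
set p := (-1) ^+ b * qsin phi - sin phi.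
have pE : p * (p + 2 * sin phi) = 1.
  rewrite (_ : _ * _ = ((-1) ^+ b) ^+ 2 * qsin phi ^+ 2 - sin phi ^+ 2).
    by rewrite sqrr_sign qsin_sqr; ring.
  by rewrite /p; ring.
rewrite (_ : _ + _ = p / (2 * sin phi)); last first.
  by rewrite /p /abs_shift; field; rewrite gt_eqF.
apply: trig_eigenvalue => //; rewrite ?gt_eqF //; first by lia.
have n2 := odd_double_half n.
move: sec; rewrite /secular; set h := n./2 in n2 *; case: (odd n) n2 => n2.
  have nE : n%:R = 2 * h%:R + 1 :> R by rewrite -natrM natr1; congr (_%:R); lia.
  rewrite (_ : n - h = h.+1)%N; last by lia.
  rewrite (_ : 2 * h%:R * phi = n%:R * phi - phi); last first.
    by rewrite nE; ring.
  rewrite (_ : (2 * h.+1%:R - 1) * phi = n%:R * phi); last first.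
    by rewrite nE -[h.+1]addn1 natrD; ring.
  by rewrite sinB => /eqP; rewrite subr_eq0 => /eqP ->; rewrite /p; ring.
have nE : n%:R = 2 * h%:R :> R by rewrite -natrM; congr (_%:R); lia.
rewrite (_ : n - h = h)%N; last by lia.
rewrite (_ : 2 * h%:R * phi = n%:R * phi); last first.
  by rewrite nE; ring.
rewrite (_ : (2 * h%:R - 1) * phi = n%:R * phi - phi); last first.
  by rewrite nE; ring.
move/eqP; rewrite subr_eq0 => /eqP sec; rewrite cosB sec.
(* By [sec], the expanded cosine equals (p + 2 sin(phi)) sin(n phi), so the factor 1 = p (p + 2
   sin(phi)) is inserted on the left. *)
transitivity (p * (p + 2 * sin phi) * sin (n%:R * phi)).
  by rewrite pE mul1r.
by rewrite /p; ring.
Qed.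

Lemma sin_in_pihalf (x : R) : 0 < x -> x <= pi / 2 -> 0 < sin x.
Proof. by move=> x0 x1; have := pi_gt0 R => pi0; apply: sin_gt0_pi; lra. Qed.

Lemma le_sin (x y : R) : 0 < x -> x <= y -> y <= pi / 2 -> sin x <= sin y.
Proof.
rewrite le_eqVlt => x0 /orP[/eqP ->|xy] y1 //; have pi0 := pi_gt0 R.
by apply/ltW; rewrite ltr_sin // in_itv /=; lra.
Qed.

(** Squaring removes the root; both the monotonicity and the Lipschitz bound of [abs_shift] rest on
    this form. *)
Lemma abs_shiftE (x : R) : 0 < sin x -> abs_shift x ^+ 2 = (1 + (sin x) ^- 2) / 4.
Proof.
by move=> s0; rewrite /abs_shift expr_div_n qsin_sqr; field; rewrite gt_eqF.
Qed.

(** This bound puts the eigenvalues of the two signs above 0 and below -1, hence apart from each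
    other and from the trivial one. *)
Lemma abs_shift_gt_half (x : R) : 0 < sin x -> 1 / 2 < abs_shift x.
Proof.
move=> s0; rewrite /abs_shift ltr_pdivlMr ?mulr_gt0 // mulrA divfK ?pnatr_eq0 // mul1r.
rewrite -(ltr_pXn2r (_ : 0 < 2)%N) ?nnegrE ?ltW ?qsin_gt0 // qsin_sqr; lra.
Qed.

Lemma abs_shift_lt (x y : R) : 0 < x -> x < y -> y <= pi / 2 -> abs_shift y < abs_shift x.
Proof.
move=> x0 xy y1; have pi0 := pi_gt0 R.
have sxy : sin x < sin y by rewrite ltr_sin // in_itv /=; lra.
have sx : 0 < sin x by apply: sin_in_pihalf; lra.
have sy := lt_trans sx sxy.
have := abs_shift_gt_half sx; have := abs_shift_gt_half sy => fy fx.
rewrite -(ltr_pXn2r (_ : 0 < 2)%N) ?nnegrE //; try lra.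
rewrite !abs_shiftE // ltr_pM2r ?invr_gt0 // ltrD2l ltf_pV2 ?posrE ?exprn_gt0 //.
by rewrite ltr_pXn2r ?nnegrE ?ltW.
Qed.

End Trigonometry.

(** * The whole spectrum *)

Lemma sorted_map_iota (T : Type) (r : rel T) (f : nat -> T) a N :
  (forall i, (a <= i)%N -> (i.+1 < a + N)%N -> r (f i) (f i.+1)) ->
  sorted r [seq f i | i <- iota a N].
Proof.
elim: N a => // -[|N] IHN a fr //.
change (r (f a) (f a.+1) && sorted r [seq f i | i <- iota a.+1 N.+1]).
rewrite fr //; last by lia.
by apply: IHN => i ai iN; apply: fr; lia.
Qed.

Section Spectrum.

Variables (R : realType) (n : nat) (e : rel 'I_n).
Hypotheses (n_gt2 : (2 < n)%N) (car : connected_antiregular e).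

(** The bound on m is the condition 2 m + 1 + b < n of [secular_root]; it leaves floor(n/2) roots
    for [false] and floor((n - 1)/2) for [true]. *)
Lemma secular_roots (b : bool) : exists phi : nat -> R,
  forall m, (m < (n - b)./2)%N ->
    [/\ (m%:R + b%:R / 2) * pi / n%:R < phi m,
        phi m < (m%:R + (b%:R + 1) / 2) * pi / n%:R & secular n b (phi m) = 0].
Proof.
have [|phi phiP] := @choice nat R (fun m phi => (m < (n - b)./2)%N ->
    [/\ (m%:R + b%:R / 2) * pi / n%:R < phi,
        phi < (m%:R + (b%:R + 1) / 2) * pi / n%:R & secular n b phi = 0]).
  move=> m; have [mn|nm] := ltnP m (n - b)./2; last by exists 0.
  have [|phi phiP] := @secular_root R n b m; last by exists phi.
  by have := odd_double_half (n - b); lia.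
by exists phi.
Qed.

Definition signed_eigenvalue (b : bool) (phi : R) : R :=
  - 1 / 2 + (-1) ^+ b * abs_shift phi.

(** The angles are taken in decreasing order because [abs_shift] decreases on (0, pi/2]; the entries
    then move away from -1/2, as in the numbering of the theorem. *)
Definition nontrivial_spectrum (b : bool) (phi : nat -> R) : seq R :=
  [seq signed_eigenvalue b (phi ((n - b)./2 - j)%N) | j <- iota 1 (n - b)./2].

Section Lists.

Variables phi : bool -> nat -> R.
Hypothesis phiP : forall (b : bool) m, (m < (n - b)./2)%N ->
    [/\ (m%:R + b%:R / 2) * pi / n%:R < phi b m,
        phi b m < (m%:R + (b%:R + 1) / 2) * pi / n%:R & secular n b (phi b m) = 0].

Let n_gt0 : 0 < n%:R :> R. Proof. by rewrite ltr0n; lia. Qed.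

Lemma phi_gt0 (b : bool) m : (m < (n - b)./2)%N -> 0 < phi b m.
Proof.
move=> /phiP[+ _ _]; apply: le_lt_trans.
rewrite divr_ge0 ?ler0n // mulr_ge0 ?pi_ge0 //.
by have := ler0n R m; case: b => /=; lra.
Qed.

Lemma phi_lt_pihalf (b : bool) m : (m < (n - b)./2)%N -> phi b m < pi / 2.
Proof.
move=> mN; have [_ phi_lt _] := phiP mN; apply: lt_le_trans phi_lt _.
have mnR : 2 * m%:R + 1 + b%:R <= n%:R :> R.
  by rewrite -natrM !natr1 -natrD ler_nat; have := odd_double_half (n - b); lia.
by rewrite ler_pdivrMr //; have := pi_gt0 R; nra.
Qed.

Lemma phi_lt (b : bool) i j : (i < j)%N -> (j < (n - b)./2)%N -> phi b i < phi b j.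
Proof.
move=> ij jN; have [phij _ _] := phiP jN.
have [_ phii _] := phiP (ltn_trans ij jN).
apply: (lt_le_trans phii); apply: le_trans (ltW phij).
have : i%:R + 1 <= j%:R :> R by rewrite natr1 ler_nat.
rewrite ler_pM2r ?invr_gt0 // ler_pM2r ?pi_gt0 //; case: b {phii phij jN} => /=; lra.
Qed.

Lemma abs_shift_phi_gt_half (b : bool) m : (m < (n - b)./2)%N -> 1 / 2 < abs_shift (phi b m).
Proof.
move=> mN; apply: abs_shift_gt_half; apply: sin_in_pihalf; first exact: phi_gt0.
by apply/ltW/phi_lt_pihalf.
Qed.

Lemma abs_shift_phi_lt (b : bool) i j :
  (i < j)%N -> (j < (n - b)./2)%N -> abs_shift (phi b j) < abs_shift (phi b i).
Proof.
move=> ij jN; apply: abs_shift_lt; [|exact: phi_lt|by apply/ltW/phi_lt_pihalf].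
by apply: phi_gt0; apply: ltn_trans jN.
Qed.

Lemma positive_spectrum_sorted :
  sorted (fun x y => x < y) (nontrivial_spectrum false (phi false)).
Proof.
apply: sorted_map_iota => i i1 iN.
rewrite /signed_eigenvalue ltrD2l !mul1r; apply: abs_shift_phi_lt; lia.
Qed.

Lemma negative_spectrum_sorted :
  sorted (fun x y => y < x) (nontrivial_spectrum true (phi true)).
Proof.
apply: sorted_map_iota => i i1 iN.
rewrite /signed_eigenvalue ltrD2l !mulN1r ltrN2; apply: abs_shift_phi_lt; lia.
Qed.

Lemma nontrivial_spectrumP b x : x \in nontrivial_spectrum b (phi b) ->
  exists2 m, (m < (n - b)./2)%N & x = signed_eigenvalue b (phi b m).
Proof.
case/mapP => j; rewrite mem_iota => jN ->; exists ((n - b)./2 - j)%N => //; lia.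
Qed.

Lemma nontrivial_spectrum_eigenvalue b x :
  x \in nontrivial_spectrum b (phi b) -> eigenvalue (adjacency_matrix R e) x.
Proof.
case/nontrivial_spectrumP => m mN ->; have [_ _ sec] := phiP mN.
by apply: secular_eigenvalue => //; [exact: phi_gt0|exact: phi_lt_pihalf].
Qed.

Lemma positive_spectrum_gt0 x :
  x \in nontrivial_spectrum false (phi false) -> 0 < x.
Proof.
case/nontrivial_spectrumP => m mN ->; have := abs_shift_phi_gt_half mN.
rewrite /signed_eigenvalue mul1r; lra.
Qed.

Lemma negative_spectrum_ltN1 x :
  x \in nontrivial_spectrum true (phi true) -> x < -1.
Proof.
case/nontrivial_spectrumP => m mN ->; have := abs_shift_phi_gt_half mN.
rewrite /signed_eigenvalue mulN1r; lra.
Qed.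

Lemma trivial_eigenvalue_bounds : -1 <= trivial_eigenvalue R n <= 0.
Proof. by rewrite /trivial_eigenvalue; case: odd; lra. Qed.

(** The three kinds already give 1 + floor(n/2) + floor((n - 1)/2) = n distinct eigenvalues, so
    another one would exceed the degree of the characteristic polynomial. *)
Lemma eigenvalue_cases x : eigenvalue (adjacency_matrix R e) x ->
  [|| x == trivial_eigenvalue R n, x \in nontrivial_spectrum false (phi false)
    | x \in nontrivial_spectrum true (phi true)].
Proof.
move=> eigx; apply/negP => /negP /norP[xt /norP[xp xn]].
have := trivial_eigenvalue_bounds; set t := trivial_eigenvalue R n in xt * => tb.
pose s := x :: t :: nontrivial_spectrum false (phi false)
                    ++ nontrivial_spectrum true (phi true).
have s_uniq : uniq s.
  rewrite /= !inE !mem_cat !negb_or xt xp xn cat_uniq /=.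
  have -> : t \notin nontrivial_spectrum false (phi false).
    by apply/negP => /positive_spectrum_gt0; lra.
  have -> : t \notin nontrivial_spectrum true (phi true).
    by apply/negP => /negative_spectrum_ltN1; lra.
  rewrite (sorted_uniq lt_trans (@ltxx _ _) positive_spectrum_sorted).
  rewrite (@sorted_uniq _ (fun y z : R => z < y)) ?negative_spectrum_sorted //=.
  - rewrite andbT; apply/hasPn => y /negative_spectrum_ltN1 y_lt.
    by apply/negP => /positive_spectrum_gt0; lra.
  - by move=> z y w yz zw; exact: lt_trans zw yz.
have : (size s <= n)%N.
  apply: (@size_uniq_eigenvalues R n e) => // y; rewrite !inE mem_cat.
  case/or4P => [/eqP ->|/eqP ->|yP|yP] //; last 2 first.
  - exact: nontrivial_spectrum_eigenvalue yP.
  - exact: nontrivial_spectrum_eigenvalue yP.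
  by apply: trivial_eigenvalueP => //; lia.
rewrite /= size_cat !size_map !size_iota; have := odd_double_half n.
by have := odd_double_half (n - 1); lia.
Qed.

Lemma positive_eigenvaluesE lp : positive_eigenvalues e lp ->
  lp = nontrivial_spectrum false (phi false).
Proof.
case=> lp_sorted lpP.
apply: (irr_sorted_eq lt_trans (@ltxx _ _) lp_sorted positive_spectrum_sorted) => x.
apply/idP/idP => [/lpP[/eigenvalue_cases/or3P[/eqP ->|//|/negative_spectrum_ltN1 xlt] xgt]|xP].
- by have := trivial_eigenvalue_bounds; lra.
- lra.
- apply/lpP; split; [exact: nontrivial_spectrum_eigenvalue xP|exact: positive_spectrum_gt0].
Qed.

Lemma negative_eigenvaluesE ln : negative_nontrivial_eigenvalues e ln ->
  ln = nontrivial_spectrum true (phi true).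
Proof.
case=> ln_sorted lnP.
have tr : transitive (fun y z : R => z < y) by move=> z y w yz zw; exact: lt_trans zw yz.
apply: (irr_sorted_eq tr _ ln_sorted negative_spectrum_sorted) => x.
  by rewrite ltxx.
apply/idP/idP => [/lnP[/eigenvalue_cases/or3P[/eqP|/positive_spectrum_gt0 xgt|//] xlt xt]|xP].
- by [].
- lra.
- have xlt := negative_spectrum_ltN1 xP; apply/lnP; split; first 1 last.
  + lra.
  + by have := trivial_eigenvalue_bounds => tb xt; rewrite -xt in tb; lra.
  + exact: nontrivial_spectrum_eigenvalue xP.
Qed.

Lemma nth_nontrivial_spectrum (b : bool) j : (0 < j <= (n - b)./2)%N ->
  (nontrivial_spectrum b (phi b))`_(j - 1) =
  signed_eigenvalue b (phi b ((n - b)./2 - j)%N).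
Proof.
move=> jN; rewrite (nth_map 0%N) ?size_iota ?nth_iota; try by lia.
by congr (signed_eigenvalue _ (phi _ _)); lia.
Qed.

(** The window does not depend on b: it is wide enough for both signs and both parities, so the
    angles of the j-th positive and negative eigenvalues differ by at most 2 pi/n. *)
Lemma phi_bounds (b : bool) j : (0 < j < n./2)%N ->
  (n./2%:R - j%:R - 1) * pi / n%:R <= phi b ((n - b)./2 - j)%N
    <= (n./2%:R - j%:R + 1) * pi / n%:R.
Proof.
move=> jh; have [n2 nb2] := (odd_double_half n, odd_double_half (n - b)).
have [|lo hi _] := @phiP b ((n - b)./2 - j)%N; first by lia.
set m := ((n - b)./2 - j)%N in lo hi *.
have mh : (m + j <= n./2)%N /\ (n./2 <= m + j + b)%N by lia.
have {mh} [mh1 mh2] : m%:R + j%:R <= n./2%:R :> R /\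
    n./2%:R <= m%:R + j%:R + b%:R :> R by rewrite -!natrD !ler_nat.
have [b0 b1] : 0 <= b%:R :> R /\ b%:R <= 1 :> R by rewrite ler0n lern1 leq_b1.
apply/andP; split; [apply: le_trans (ltW lo) | apply: le_trans (ltW hi) _].
  by rewrite ler_pM2r ?invr_gt0 // ler_pM2r ?pi_gt0 //; lra.
by rewrite ler_pM2r ?invr_gt0 // ler_pM2r ?pi_gt0 //; lra.
Qed.

End Lists.

Lemma eigenvalue_pair (lp ln : seq R) (j : nat) :
  positive_eigenvalues e lp -> negative_nontrivial_eigenvalues e ln ->
  (0 < j < n./2)%N ->
  exists x y : R,
    [/\ lp`_(j - 1) + ln`_(j - 1) + 1 = abs_shift x - abs_shift y,
        (n./2%:R - j%:R - 1) * pi / n%:R <= x <= (n./2%:R - j%:R + 1) * pi / n%:R,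
        (n./2%:R - j%:R - 1) * pi / n%:R <= y <= (n./2%:R - j%:R + 1) * pi / n%:R,
        x <= pi / 2 & y <= pi / 2].
Proof.
move=> lpP lnP jh; have [phi0 phi0P] := secular_roots false.
have [phi1 phi1P] := secular_roots true.
pose phi b := if b then phi1 else phi0.
have phiP : forall (b : bool) m, (m < (n - b)./2)%N ->
    [/\ (m%:R + b%:R / 2) * pi / n%:R < phi b m,
        phi b m < (m%:R + (b%:R + 1) / 2) * pi / n%:R & secular n b (phi b m) = 0].
  by case.
have n2 := odd_double_half n; have n12 := odd_double_half (n - 1).
exists (phi false (n./2 - j)%N), (phi true ((n - 1)./2 - j)%N).
rewrite (positive_eigenvaluesE phiP lpP) (negative_eigenvaluesE phiP lnP).
rewrite !nth_nontrivial_spectrum ?subn0; try lia.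
split.
- by rewrite /signed_eigenvalue /= ?subn0; field.
- by have /= := phi_bounds phiP false jh; rewrite subn0.
- exact: (phi_bounds phiP true jh).
- by apply/ltW/phi_lt_pihalf => //=; lia.
- by apply/ltW/phi_lt_pihalf => //=; lia.
Qed.

End Spectrum.

(** * Asymptotics *)

Lemma sin_lipschitz (R : realType) (x y : R) : `|sin x - sin y| <= `|x - y|.
Proof.
wlog xy : x y / y <= x.
  move=> WH; have [/WH //|/ltW/WH] := leP y x.
  by rewrite distrC [leRHS]distrC.
have [|z _ ->] := MVT_segment xy (fun z _ => is_derive_sin z).
  exact/continuous_subspaceT/continuous_sin.
by rewrite normrM ler_piMl // cos_max.
Qed.

(** The difference of squares is explicit by [abs_shiftE], and the sum [abs_shift x + abs_shift y]
    exceeds 1, so multiplying by it only enlarges the left side. *)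
Lemma abs_shift_dist (R : realType) (sigma x y : R) :
  0 < sigma -> sigma <= sin x -> sigma <= sin y ->
  `|abs_shift x - abs_shift y| <= `|x - y| / (2 * sigma ^+ 4).
Proof.
move=> sg0 sx sy; have [sx0 sy0] := (lt_le_trans sg0 sx, lt_le_trans sg0 sy).
have fx := abs_shift_gt_half sx0; have fy := abs_shift_gt_half sy0.
have prodE : (abs_shift x - abs_shift y) * (abs_shift x + abs_shift y) =
    (sin y - sin x) * ((sin x + sin y) / (4 * sin x ^+ 2 * sin y ^+ 2)).
  rewrite -subr_sqr !abs_shiftE //; field.
  by rewrite !gt_eqF.
have coef : 0 <= (sin x + sin y) / (4 * sin x ^+ 2 * sin y ^+ 2) <= (2 * sigma ^+ 4)^-1.
  apply/andP; split.
    by rewrite divr_ge0 ?addr_ge0 ?ltW // !mulr_gt0 ?exprn_gt0.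
  have s1 := sin_le1 x; have s2 := sin_le1 y.
  apply: (@le_trans _ _ (2 / (4 * sigma ^+ 2 * sigma ^+ 2))).
    have sq z : sigma <= sin z -> sigma ^+ 2 <= sin z ^+ 2 
      by move=> sz; rewrite lerXn2r // nnegrE ltW // (lt_le_trans sg0).
    have sg2 : 0 < sigma ^+ 2 by rewrite exprn_gt0.
    have den : 4 * sigma ^+ 2 * sigma ^+ 2 <= 4 * sin x ^+ 2 * sin y ^+ 2.
      rewrite -2!(mulrA 4) ler_pM2l //.
      by rewrite (ler_pM (ltW sg2) (ltW sg2)) ?sq.
    have den0 : 0 < 4 * sigma ^+ 2 * sigma ^+ 2 by rewrite !mulr_gt0.
    apply: ler_pM; [lra| |lra|].
      by rewrite invr_ge0; lra.
    by rewrite lef_pV2 // posrE; lra.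
  by rewrite le_eqVlt; apply/orP; left; apply/eqP; field; rewrite gt_eqF.
case/andP: coef => coef0 coef1.
apply: (@le_trans _ _ (`|sin y - sin x| * (2 * sigma ^+ 4)^-1)); last first.
  apply: ler_wpM2r; first by rewrite invr_ge0 mulr_ge0 ?exprn_ge0 ?ltW.
  by rewrite [leRHS]distrC sin_lipschitz.
apply: (@le_trans _ _ (`|(abs_shift x - abs_shift y) * (abs_shift x + abs_shift y)|)).
  by rewrite normrM ler_peMr // ger0_norm; lra.
by rewrite prodE normrM ler_wpM2l // ger0_norm.
Qed.

Lemma abs_shift_close (R : realType) (r eps : R) : r < 1 -> 0 < eps ->
  exists K : nat, forall n j (x y : R), (K <= n./2)%N -> j%:R <= r * n./2%:R ->
    (n./2%:R - j%:R - 1) * pi / n%:R <= x <= (n./2%:R - j%:R + 1) * pi / n%:R ->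
    (n./2%:R - j%:R - 1) * pi / n%:R <= y <= (n./2%:R - j%:R + 1) * pi / n%:R ->
    x <= pi / 2 -> y <= pi / 2 -> `|abs_shift x - abs_shift y| < eps.
Proof.
move=> r1 eps0; have pi0 := pi_gt0 R.
have [r_ge0|r_lt0] := leP 0 r; last first.
  exists 1%N => n j x y h1 jh; exfalso.
  have h0 : 0 < n./2%:R :> R by rewrite ltr0n.
  have := ler0n R j; have : r * n./2%:R < 0 by rewrite nmulr_rlt0.
  lra.
(* With h = n./2, the bounds j <= r h, (1 - r) h > 2 and n <= 3 h make the lower end of the window
   at least ((1 - r) h / 2) pi / (3 h) = [delta]. *)
set delta := (1 - r) * pi / 6.
have d0 : 0 < delta by rewrite divr_gt0 // mulr_gt0 // subr_gt0.
have d1 : delta <= pi / 2.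
  have rpi : 0 <= r * pi by exact: mulr_ge0 r_ge0 (ltW pi0).
  by rewrite /delta; lra.
set sigma := sin delta; have sg0 : 0 < sigma by exact: sin_in_pihalf.
set c := 2 * sigma ^+ 4; have c0 : 0 < c by rewrite mulr_gt0 ?exprn_gt0.
have nat_above (z : R) : exists k : nat, z < k%:R.
  by exists (Num.truncn z).+1; exact: truncnS_gt.
have [[K1 K1P] [K2 K2P]] := (nat_above (2 / (1 - r)), nat_above (pi / (c * eps))).
(* The bound 1 gives n <= 3 h, [K1] gives (1 - r) h > 2, and [K2] makes the window length 2 pi/n
   smaller than c eps. *)
exists (maxn 1 (maxn K1 K2)) => n j x y; rewrite !geq_max.
set h := n./2 => /and3P[h1 K1h K2h] jh xP yP x_le y_le.
have hr : 2 < (1 - r) * h%:R.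
  rewrite mulrC -ltr_pdivrMr ?subr_gt0 //.
  by apply: lt_le_trans K1P _; rewrite ler_nat.
have hc : pi < h%:R * (c * eps).
  rewrite -ltr_pdivrMr ?mulr_gt0 //.
  by apply: lt_le_trans K2P _; rewrite ler_nat.
have h0 : 0 < h%:R :> R by rewrite ltr0n.
have [nh1 nh2] : 2 * h%:R <= n%:R :> R /\ n%:R <= 3 * h%:R :> R.
  rewrite -!natrM !ler_nat -(odd_double_half n) -/h -!mul2n.
  by move: h1; clear; case: odd; lia.
have n0 : 0 < n%:R :> R by lra.
have delta_le z : (h%:R - j%:R - 1) * pi / n%:R <= z -> delta <= z.
  apply: le_trans; rewrite ler_pdivlMr // /delta.
  rewrite (_ : _ / 6 * _ = ((1 - r) * n%:R / 6) * pi); last by ring.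
  rewrite ler_pM2r //.
  have : (1 - r) * n%:R <= (1 - r) * (3 * h%:R) by rewrite ler_pM2l // subr_gt0.
  by lra.
have sin_ge z : (h%:R - j%:R - 1) * pi / n%:R <= z -> z <= pi / 2 -> sigma <= sin z.
  by move=> /delta_le dz z1; apply: le_sin.
case/andP: xP => xlo xhi; case/andP: yP => ylo yhi.
apply: (le_lt_trans (abs_shift_dist sg0 (sin_ge _ xlo x_le) (sin_ge _ ylo y_le))).
rewrite -/c ltr_pdivrMr //.
have xy : `|x - y| <= 2 * pi / n%:R.
  have hiE : (h%:R - j%:R + 1) * pi / n%:R =
      (h%:R - j%:R - 1) * pi / n%:R + 2 * pi / n%:R :> R by ring.
  by rewrite ler_norml; lra.
apply: (le_lt_trans xy); rewrite ltr_pdivrMr //.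
have : 2 * h%:R * (c * eps) <= n%:R * (c * eps) by rewrite ler_pM2r // mulr_gt0.
by lra.
Qed.

Theorem theorem2p5 (R : realType) (r eps : R) (r_gt0 : 0 < r) (r_lt1 : r < 1)
    (eps_gt0 : 0 < eps) :
  (exists K : nat, forall k : nat, (K <= k)%N ->
     forall (e : rel 'I_(2 * k)) (lp ln : seq R),
       connected_antiregular e ->
       positive_eigenvalues e lp ->
       negative_nontrivial_eigenvalues e ln ->
       forall j : nat, (1 <= j)%N -> (j <= k - 1)%N ->
         2 * j%:R / (2 * k%:R - 1) <= r ->
         `|lp`_(j - 1) + ln`_(j - 1) + 1| < eps)
  /\
  (exists K : nat, forall k : nat, (K <= k)%N ->
     forall (e : rel 'I_(2 * k + 1)) (lp ln : seq R),
       connected_antiregular e ->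
       positive_eigenvalues e lp ->
       negative_nontrivial_eigenvalues e ln ->
       forall j : nat, (1 <= j)%N -> (j <= k - 1)%N ->
         j%:R / k%:R <= r ->
         `|lp`_(j - 1) + ln`_(j - 1) + 1| < eps).
Proof.
have [K KP] := abs_shift_close r_lt1 eps_gt0.
(* The shift by 2 ensures n > 2, as [eigenvalue_pair] requires. *)
split; exists K.+2 => k Kk e lp ln car lpP lnP j j1 jk jr.
- have half : ((2 * k)./2 = k)%N by lia.
  have [| |x [y [-> xP yP x1 y1]]] := eigenvalue_pair _ car lpP lnP (j := j).
  + by lia.
  + by lia.
  apply: KP xP yP x1 y1; first by lia.
  have k1 : 1 <= k%:R :> R by rewrite ler1n; lia.
  (* Since r > 0, 2 j <= r (2 k - 1) implies j <= r k. *)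
  by move: jr; rewrite half ler_pdivrMr; lra.
- have half : ((2 * k + 1)./2 = k)%N by lia.
  have [| |x [y [-> xP yP x1 y1]]] := eigenvalue_pair _ car lpP lnP (j := j).
  + by lia.
  + by lia.
  apply: KP xP yP x1 y1; first by lia.
  have k0 : 0 < k%:R :> R by rewrite ltr0n; lia.
  by move: jr; rewrite half ler_pdivrMr.
Qed.
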